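(* The smallest $\pi$-weight of a countable non-S-separable Tychonoff space is $\mathfrak{d}$. That is, every countable Tychonoff space $X$ that is not S-separable satisfies $\pi w(X)\ge\mathfrak{d}$, and there exists a countable Tychonoff space $Y$ with $\pi w(Y)=\mathfrak{d}$ that is not S-separable.
   Context: A space $X$ is S-separable if for every sequence $(Y_n)_{n\in\mathbb{N}}$ of dense subspaces of $X$ there exists a sequence $(F_n)_{n\in\mathbb{N}}$ such that each $F_n$ is a finite subset of $Y_n$ and for each finite collection $\mathcal{F}$ of nonempty open sets of $X$ there exists $n\in\mathbb{N}$ with $U\cap F_n\neq\emptyset$ for all $U\in\mathcal{F}$. A $\pi$-base of $X$ is a collection $\mathcal{B}$ of open sets such that every nonempty open set of $X$ contains a nonempty member of $\mathcal{B}$; the $\pi$-weight $\pi w(X)$ is the minimal cardinality of a $\pi$-base of $X$. $\mathfrak{d}$ is the dominating number: the least cardinality of a set $D\subseteq\mathbb{N}^{\mathbb{N}}$ such that for every $f\in\mathbb{N}^{\mathbb{N}}$ there is $g\in D$ with $f(n)\le g(n)$ for all but finitely many $n$. *)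

(* Defs.v *)
From HB Require Import structures.
From mathcomp Require Import all_boot all_order.
From mathcomp Require Import all_classical all_reals all_analysis.

Set Implicit Arguments.
Unset Strict Implicit.
Unset Printing Implicit Defensive.

Local Open Scope classical_set_scope.
Local Open Scope card_scope.

(* There is no type of cardinal numbers in the library: the least cardinality
   attained by the members of a nonempty family P of sets is represented by a
   member of P realizing it. The default value set0 only matters when P is
   empty, by [least_cardP]. *)
Definition least_card {T : Type} (P : set (set T)) : set T :=
  xget set0 [set A | P A /\ forall B, P B -> A #<= B].

(* Well-foundedness of cardinals, by Zorn's lemma on the sets of choice
   functions of P that are injective at every coordinate. *)
Lemma exists_least_card {T : Type} (P : set (set T)) :
  P !=set0 -> exists A, P A /\ forall B, P B -> A #<= B.
Proof.
move=> [A0 PA0].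
pose Q : set (set (set T -> T)) := [set S |
  (forall f, S f -> forall A, P A -> A (f A)) /\
  (forall f g, S f -> S g -> forall A, P A -> f A = g A -> f = g)].
have [F FQ totF|S [[Sch Sinj] Smax]] := @Zorn_bigcup _ Q.
  split=> [f [C FC Cf]|f g [C FC Cf] [D FD Dg]].
    by case: (FQ _ FC) => + _; apply.
  have [CD|DC] := totF C D FC FD.
  - by case: (FQ _ FD) => _; apply => //; exact: CD.
  - by case: (FQ _ FC) => _; apply => //; exact: DC.
have [A [PA Ahit]] : exists A, P A /\ forall x, A x -> exists2 f, S f & f A = x.
  apply: contrapT => nex.
  have miss A : P A -> exists x, A x /\ forall f, S f -> f A <> x.
    move=> PA; apply: contrapT => nx; apply: nex; exists A; split=> // x Ax.
    apply: contrapT => nf; apply: nx; exists x; split=> // f Sf fAx.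
    by apply: nf; exists f.
  have [x0 _] := miss _ PA0.
  have /choice[g gP] A :
      exists x, P A -> A x /\ forall f, S f -> f A <> x.
    have [PA|nPA] := pselect (P A); last by exists x0.
    by have [x xP] := miss A PA; exists x.
  have SgS : S `<` g |` S.
    split; first by move=> f Sf; right.
    by move=> /(_ g (or_introl erefl)) Sg; exact: (gP _ PA0).2 Sg erefl.
  case: (Smax _ SgS).
  split=> [f [->|Sf] A PA|f h [->|Sf] [->|Sh] A PA fh] //.
  - exact: (gP A PA).1.
  - exact: (Sch f Sf A PA).
  - by case: ((gP A PA).2 h Sh).
  - by case: ((gP A PA).2 f Sf).
  - exact: (Sinj f h Sf Sh A PA fh).
exists A; split=> // B PB; apply: (@card_le_trans _ _ _ S).
  apply: (card_le_trans _ (card_image_le (fun f => f A) S)).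
  by apply: subset_card_le => x /Ahit[f Sf <-]; exists f.
have injB : {in S &, injective (fun f : set T -> T => f B)}.
  by move=> f g; rewrite !inE => Sf Sg; exact: (Sinj f g Sf Sg B PB).
rewrite -(card_le_eql (inj_card_eq injB)); apply: subset_card_le.
by move=> _ [f Sf <-]; exact: (Sch f Sf B PB).
Qed.

Lemma least_cardP {T : Type} (P : set (set T)) : P !=set0 ->
  P (least_card P) /\ forall B, P B -> least_card P #<= B.
Proof.
move=> /exists_least_card[A AP]; rewrite /least_card.
by case: xgetP => [_ _ //|/(_ A)]; case.
Qed.

(* [completely_regular_space] is phrased with [uniform_separator]; by
   [uniform_separatorP] this is separation of a point from a closed set by a
   continuous function into [0, 1]. *)
Definition tychonoff_space (X : topologicalType) : Prop :=
  hausdorff_space X /\ completely_regular_space X.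

Definition S_separable (X : topologicalType) : Prop :=
  forall Y : nat -> set X, (forall n, dense (Y n)) ->
  exists F : nat -> set X,
    (forall n, finite_set (F n) /\ F n `<=` Y n) /\
    forall UU : set (set X), finite_set UU ->
      (forall U, UU U -> open U /\ U !=set0) ->
      exists n, forall U, UU U -> U `&` F n !=set0.

Definition pi_base (X : topologicalType) (B : set (set X)) : Prop :=
  (forall V, B V -> open V) /\
  forall U : set X, open U -> U !=set0 ->
    exists V, [/\ B V, V !=set0 & V `<=` U].

Definition pi_weight (X : topologicalType) : set (set X) :=
  least_card (@pi_base X).
Arguments pi_weight : clear implicits.

Lemma pi_weightP (X : topologicalType) : pi_base (pi_weight X) /\
  forall B : set (set X), pi_base B -> pi_weight X #<= B.
Proof.
by apply: least_cardP; exists open; split=> // U oU U0; exists U; split.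
Qed.

Definition dominating (D : set (nat -> nat)) : Prop :=
  forall f : nat -> nat, exists2 g, D g & \forall n \near \oo, f n <= g n.

Definition dominating_number : set (nat -> nat) := least_card dominating.

Lemma dominating_numberP : dominating dominating_number /\
  forall D, dominating D -> dominating_number #<= D.
Proof.
by apply: least_cardP; exists setT => f; exists f => //; exact: nearW.
Qed.

(* Main.v *)
(** Lower bound: fix dense sets [Y n] that refute S-separability and a pi-base B,
    and pick a point of V in each [Y n] for every V in B. Coding X by naturals,
    the choices become a function [phi V]; finite maxima of these functions
    dominate, because an f escaping all of them would give the selection
    [F n = {y in Y n | code y <= f n}]. An infinite B has no more finite
    sequences than members, so B has at least d elements.

    Example: on a countable set split into levels, take for each (j, d) with d
    in a dominating family D a set avoiding, on level n, all points with code at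
    most d n, in such a way that the sets are independent on each level. With
    these sets and their complements as a subbase each level is dense, and a
    finite selection from the levels, being bounded by some d in D from some
    level on, misses the set of (j, d) once j is large. *)
Require Import Defs.
From mathcomp Require Import finmap all_boot all_order.
From mathcomp Require Import all_classical all_reals all_analysis.
From mathcomp Require Import Rstruct.

Set Implicit Arguments.
Unset Strict Implicit.
Unset Printing Implicit Defensive.

Local Open Scope classical_set_scope.
Local Open Scope card_scope.

(** * Cardinality of the set of finite sequences of an infinite set *)

Lemma card_le_funP {T U : Type} (A : set T) (B : set U) (u : U) :
  A #<= B <->
  exists2 f : T -> U, set_fun A B f & forall x y, A x -> A y -> f x = f y -> x = y.
Proof.
split=> [/card_leP[g]|[f fAB finj]].
  exists (fun x => if pselect (A x) is left Ax
                  then val (g (exist _ x (mem_set Ax))) else u).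
    move=> x Ax; case: pselect => // Ax'; exact: set_valP.
  move=> x y Ax Ay; case: pselect => // Ax'; case: pselect => // Ay'.
  by move/val_inj/inj; rewrite !inE => /(_ I I) [].
have finj' : set_inj A f by move=> x y; rewrite !inE => *; exact: finj.
rewrite -(card_le_eql (inj_card_eq finj')); apply: subset_card_le.
by move=> _ [x Ax <-]; exact: fAB.
Qed.

(** A least member of the pair [[set A; B]] lies below the other one. *)
Lemma card_le_total {T : Type} (A B : set T) : A #<= B \/ B #<= A.
Proof.
have [|C [[->|->] leC]] := @exists_least_card T [set A; B].
- by exists A; left.
- by left; apply: leC; right.
- by right; apply: leC; left.
Qed.

Definition seqs {T : eqType} (A : set T) : set (seq T) := [set s | [set` s] `<=` A].

Lemma seqs_cons {T : eqType} (A : set T) (x : T) (s : seq T) :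
  seqs A (x :: s) <-> A x /\ seqs A s.
Proof.
split=> [h|[Ax h] y /=]; last by rewrite inE => /predU1P[->|/h].
by split=> [|y ys]; apply: h; rewrite /= inE ?eqxx// ys orbT.
Qed.

Lemma sub_seqs {T : eqType} (A B : set T) : A `<=` B -> seqs A `<=` seqs B.
Proof. by move=> AB s As x /As/AB. Qed.

Lemma seqs_map {T U : eqType} (A : set T) (B : set U) (f : T -> U) (s : seq T) :
  set_fun A B f -> seqs A s -> seqs B (map f s).
Proof. by move=> fAB As y /= /mapP[x /As Ax ->]; exact: fAB. Qed.

Lemma seqs_map_inj {T U : eqType} (A : set T) (f : T -> U) :
  (forall x y, A x -> A y -> f x = f y -> x = y) ->
  forall s t, seqs A s -> seqs A t -> map f s = map f t -> s = t.
Proof.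
move=> finj; elim=> [|x s IHs] [|y t]//= /seqs_cons[Ax As] /seqs_cons[Ay At].
by case=> /finj -> // /IHs ->.
Qed.

Lemma card_le_seqs {T U : eqType} (A : set T) (B : set U) :
  A #<= B -> seqs A #<= seqs B.
Proof.
move=> AB.
have [->|/set0P[x Ax]] := eqVneq A set0.
  apply/(card_le_funP _ _ [::]); exists (fun=> [::]) => // s t.
  by case: s => [|x s /seqs_cons[]//]; case: t => [|x t _ /seqs_cons[]//].
have [u0] : inhabited U.
  move: AB => /card_leP[f].
  exact: inhabits (val (f (exist _ x (mem_set Ax)))).
move/(card_le_funP _ _ u0): AB => [f fAB finj].
apply/(card_le_funP _ _ [::]); exists (map f).
  by move=> s; exact: seqs_map.
by move=> s t; exact: seqs_map_inj.
Qed.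

(** Starting point for Zorn's lemma: M is a copy of the naturals in A, whose finite sequences
    [pickle] codes by naturals. *)
Lemma infinite_seqs_inj {T : eqType} (A : set T) : infinite_set A ->
  exists M (f : seq T -> T), [/\ infinite_set M, M `<=` A, set_fun (seqs M) M f &
    forall s t, seqs M s -> seqs M t -> f s = f t -> s = t].
Proof.
move=> Ainf; have [x0 _] := infinite_setN0 Ainf.
move/infiniteP/(card_le_funP _ _ x0): (Ainf) => [e eA einj].
have einj' : injective e by move=> m n /einj; exact.
have /choice[g gP] x : exists n, range e x -> e n = x.
  have [[n _ <-]|nex] := pselect (range e x); first by exists n.
  by exists 0.
exists (range e), (e \o pickle \o map g); split.
- move=> efin; apply: infinite_nat; apply: card_le_finite efin.
  by rewrite (card_le_eqr (inj_card_eq (in2W einj'))).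
- by move=> _ [n _ <-]; exact: eA.
- by move=> s _; exists (pickle (map g s)).
move=> s t es et /= /einj' /(pcan_inj pickleK).
have gK u : seqs (range e) u -> map e (map g u) = u.
  by elim: u => //= x u IHu /seqs_cons[/gP -> /IHu ->].
by move=> /(congr1 (map e)); rewrite !gK.
Qed.

(* Zorn: a maximal M carrying an injection of its finite sequences into itself
   is equipotent to A, since otherwise A contains a copy of M disjoint from M,
   onto which the injection extends. *)
Lemma card_seqs_le {T : eqType} (A : set T) : infinite_set A -> seqs A #<= A.
Proof.
move=> Ainf; have [M0 [f0 ok0]] := infinite_seqs_inj Ainf.
pose ok (p : set T * (seq T -> T)) := [/\ infinite_set p.1, p.1 `<=` A,
    set_fun (seqs p.1) p.1 p.2 &
    forall s t, seqs p.1 s -> seqs p.1 t -> p.2 s = p.2 t -> s = t].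
pose le (p q : {p | ok p}) := `[< (sval p).1 `<=` (sval q).1 /\
    forall s, seqs (sval p).1 s -> (sval p).2 s = (sval q).2 s >].
have [|p q r /asboolP[pq1 pq2] /asboolP[qr1 qr2]|S Stot|[[M f] okM]] :=
    @ZL_preorder {p | ok p} (exist _ (M0, f0) ok0) le.
- by move=> p; apply/asboolP; split=> [x|].
- apply/asboolP; split; first exact: subset_trans qr1.
  by move=> s ps; rewrite pq2// qr2//; exact: sub_seqs ps.
- have [->|/set0P[p0 Sp0]] := eqVneq S set0; first by exists (exist _ (M0, f0) ok0).
  pose M := \bigcup_(p in S) (sval p).1.
  (* A finite sequence in the union of a chain already lies in one member. *)
  have Mseqs s : seqs M s -> exists2 p, S p & seqs (sval p).1 s.
    elim: s => [_|x s IHs /seqs_cons[[p Sp px] /IHs[q Sq qs]]]; first by exists p0.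
    have [/asboolP[pq _]|/asboolP[qp _]] := Stot _ _ Sp Sq.
    - by exists q => //; apply/seqs_cons; split=> //; exact: pq.
    - by exists p => //; apply/seqs_cons; split=> //; exact: sub_seqs qs.
  have /choice[f fP] s : exists x, seqs M s ->
      forall p, S p -> seqs (sval p).1 s -> (sval p).2 s = x.
    have [/Mseqs[p Sp ps]|nMs] := pselect (seqs M s); last by exists (f0 [::]).
    exists ((sval p).2 s) => _ q Sq qs.
    by have [/asboolP[_ ->]|/asboolP[_ ->]] := Stot _ _ Sp Sq.
  have MS p : S p -> (sval p).1 `<=` M by move=> Sp x px; exists p.
  have okM : ok (M, f).
    split=> /=.
    - by apply: sub_infinite_set (MS _ Sp0) _; case: (svalP p0).
    - by move=> x [p Sp px]; case: (svalP p) => _ + _ _; exact.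
    - move=> s Ms; have [p Sp ps] := Mseqs _ Ms; rewrite -(fP s Ms p Sp ps).
      by apply: (MS _ Sp); case: (svalP p) => _ _ + _; exact.
    - move=> s t Ms Mt; have [p Sp ps] := Mseqs _ Ms; have [q Sq qt] := Mseqs _ Mt.
      have [/asboolP[pq _]|/asboolP[qp _]] := Stot _ _ Sp Sq.
      + have qs := sub_seqs pq ps; rewrite -(fP s Ms q Sq qs) -(fP t Mt q Sq qt).
        by case: (svalP q) => _ _ _; exact.
      + have pt := sub_seqs qp qt; rewrite -(fP s Ms p Sp ps) -(fP t Mt p Sp pt).
        by case: (svalP p) => _ _ _; exact.
  exists (exist _ (M, f) okM) => p Sp; apply/asboolP; split=> /=; first exact: MS.
  by move=> s ps; apply: fP => //; exact: sub_seqs (MS _ Sp) _ ps.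
move=> Mmax; have [/= Minf MA fM finj] := okM; have [x0 Mx0] := infinite_setN0 Minf.
(* [k] merges M and a disjoint set that injects into M back into M. *)
have fold (B : set T) (h : T -> T) : set_fun B M h ->
    (forall x y, B x -> B y -> h x = h y -> x = y) ->
    exists2 k : T -> T, set_fun (M `|` B) M k &
      forall x y, (M `|` B) x -> (M `|` B) y -> k x = k y -> x = y.
  move=> hM hinj.
  have seq1 x : M x -> seqs M [:: x] by move=> Mx; apply/seqs_cons.
  have seq2 x : M x -> seqs M [:: x; x] by move=> Mx; do 2?[apply/seqs_cons; split=> //].
  (* Coding by sequences of length 1 on M and 2 on the rest keeps the two images disjoint. *)
  exists (fun x => if pselect (M x) then f [:: x] else f [:: h x; h x]).
    move=> x; case: pselect => [Mx _|nMx [//|Bx]]; first exact/fM/seq1.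
    exact/fM/seq2/hM.
  move=> x y MBx MBy; case: pselect => [Mx|nMx]; case: pselect => [My|nMy].
  - by move=> /finj -/(_ (seq1 _ Mx) (seq1 _ My))[].
  - case: MBy => // By.
    by move=> /finj -/(_ (seq1 _ Mx) (seq2 _ (hM _ By))).
  - case: MBx => // Bx.
    by move=> /finj -/(_ (seq2 _ (hM _ Bx)) (seq1 _ My)).
  - case: MBx => // Bx; case: MBy => // By.
    move=> /finj -/(_ (seq2 _ (hM _ Bx)) (seq2 _ (hM _ By)))[+ _].
    exact: hinj.
(* If [A \ M] injects into M, folding gives A below M. Otherwise [h] copies M into [A \ M], which
   contradicts maximality. *)
have [|] := card_le_total (A `\` M) M => /(card_le_funP _ _ x0)[h hM hinj].
  have [k kM kinj] := fold _ _ hM hinj.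
  rewrite setDUK in kM kinj => //.
  have AM : A #<= M by apply/(card_le_funP _ _ x0); exists k.
  apply: (card_le_trans (card_le_seqs AM)).
  by apply: (card_le_trans _ (subset_card_le MA)); apply/(card_le_funP _ _ x0); exists f.
have /choice[g gP] x : exists y, (h @` M) x -> M y /\ h y = x.
  have [[y My <-]|nh] := pselect ((h @` M) x); first by exists y.
  by exists x0.
have [|x y hx hy gxy|k kM kinj] := fold (h @` M) g.
- by move=> x /gP[].
- by rewrite -(gP x hx).2 -(gP y hy).2 gxy.
pose M' := M `|` h @` M.
(* A sequence not inside M is folded into M, coded there, and moved by [h] outside M, away from the
   old values. *)
pose f' s := if pselect (seqs M s) then f s else h (f (map k s)).
have kseqs s : seqs M' s -> seqs M (map k s) by exact: seqs_map.
have okM' : ok (M', f').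
  split=> /=.
  - by apply: sub_infinite_set Minf; left.
  - by move=> x [/MA//|[y /hM[Ah _] <-]].
  - move=> s /kseqs ks; rewrite /f'; case: pselect => [Ms|nMs]; first by left; exact: fM.
    by right; exists (f (map k s)) => //; exact: fM.
  - move=> s t M's M't; rewrite /f'.
    have nMh u : seqs M' u -> ~ M (h (f (map k u))) by move=> /kseqs/fM/hM[].
    case: pselect => [Ms|nMs]; case: pselect => [Mt|nMt].
    + exact: finj.
    + by move=> /= fh; case: (nMh t M't); rewrite -fh; exact: fM.
    + by move=> /= fh; case: (nMh s M's); rewrite fh; exact: fM.
    + move=> /hinj -/(_ (fM _ (kseqs _ M's)) (fM _ (kseqs _ M't))).
      move=> /finj -/(_ (kseqs _ M's) (kseqs _ M't)).
      exact: seqs_map_inj kinj _ _ M's M't.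
have /asboolP[/= M'M _] : le (exist _ (M', f') okM') (exist _ (M, f) okM).
  apply: Mmax; apply/asboolP; split=> /=; first by left.
  by move=> s Ms; rewrite /f'; case: pselect.
by have [_ []] := hM _ Mx0; apply: M'M; right; exists x0.
Qed.

(** * Lower bound *)

(** Diagonal argument: one plus the maximum of the first n+1 functions at n exceeds each listed
    function from its index on. *)
Lemma dominating_uncountable (D : set (nat -> nat)) :
  dominating D -> ~ countable D.
Proof.
move=> Ddom /countable_injP[c cinj].
have /choice[g gP] i : exists f : nat -> nat, forall d, D d -> c d = i -> f = d.
  have [[d [Dd cd]]|nex] := pselect (exists d, D d /\ c d = i).
    by exists d => d' Dd' cd'; apply: cinj; rewrite ?inE ?cd.
  by exists (fun=> 0) => d Dd cd; case: nex; exists d.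
have [d Dd [N _ hd]] := Ddom (fun n => (\max_(i < n.+1) g i n).+1).
have := hd (maxn N (c d)) (leq_maxl _ _); apply/negP; rewrite -ltnNge ltnS.
have cdlt : c d < (maxn N (c d)).+1 by rewrite ltnS leq_maxr.
have {1}<- := gP _ _ Dd erefl.
exact: (leq_bigmax (Ordinal cdlt)).
Qed.

Lemma dominating_le_pi_base (X : topologicalType) (B : set (set X)) :
  countable [set: X] -> pi_base B -> ~ S_separable X -> dominating_number #<= B.
Proof.
move=> /countable_injP[e einj] [Bopen Bpi] nS.
have [Y] : exists Y : nat -> set X, (forall n, dense (Y n)) /\ ~ exists F : nat -> set X,
    (forall n, finite_set (F n) /\ F n `<=` Y n) /\
    forall UU : set (set X), finite_set UU -> (forall U, UU U -> open U /\ U !=set0) ->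
      exists n, forall U, UU U -> U `&` F n !=set0.
  apply: contrapT => nY; apply: nS => Y Yd; apply: contrapT => nF.
  by apply: nY; exists Y.
case=> Yd nF.
have /choice[phi phiP] V : exists f : nat -> nat, B V -> V !=set0 ->
    forall n, exists2 y, (V `&` Y n) y & e y = f n.
  have [[BV V0]|nBV] := pselect (B V /\ V !=set0); last first.
    by exists (fun=> 0) => BV V0; case: nBV.
  have /choice[y yP] n : exists y, (V `&` Y n) y by exact: Yd (Bopen _ BV).
  by exists (e \o y) => _ _ n; exists (y n).
pose Phi (s : seq (set X)) n := \max_(V <- s) phi V n.
have Phidom : dominating (Phi @` seqs B).
  move=> f; apply: contrapT => nPhi; apply: nF.
  exists (fun n => Y n `&` [set y | e y <= f n]); split=> [n|UU UUfin UUopen].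
    split; last by move=> y [].
    apply: (sub_finite_set (@subIsetr _ _ _)).
    rewrite (_ : [set y | _] = e @^-1` `I_(f n).+1) //.
    apply: finite_preimage (finite_II _) => x y _ _; exact: (einj x y (in_setT _) (in_setT _)).
  have /choice[v vP] U : exists V, UU U -> [/\ B V, V !=set0 & V `<=` U].
    have [/UUopen[Uo U0]|] := pselect (UU U); last by exists set0.
    by have [V VP] := Bpi U Uo U0; exists V.
  have /finite_seqP[s sE] := UUfin.
  apply: contrapT => nhit; apply: nPhi; exists (Phi (map v s)).
    exists (map v s) => //; apply: (@seqs_map _ _ UU) => [U /vP[]//|].
    by rewrite /seqs /= sE.
  (* Where [Phi (map v s) n < f n], the chosen points of all [v U] have code below [f n], so the
     selection at n meets every U. *)
  apply: nearW => n; apply: contrapT => /negP; rewrite -ltnNge => Phif.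
  apply: nhit; exists n => U UUU; have [BV V0 VU] := vP _ UUU.
  have [y [Vy Yy] ey] := phiP _ BV V0 n; exists y; split; first exact: VU.
  split=> //=; rewrite ey; apply: leq_trans (ltnW Phif).
  rewrite /Phi big_map; move: UUU; rewrite sE /= => Us.
  by rewrite (big_rem _ Us) leq_maxl.
have le1 : dominating_number #<= seqs B.
  apply: card_le_trans (card_image_le Phi _).
  exact: dominating_numberP.2.
have [Bfin|Binf] := pselect (finite_set B); last exact: card_le_trans (card_seqs_le Binf).
(* A finite B would give a countable dominating family of functions [Phi s]. *)
case: (dominating_uncountable dominating_numberP.1).
have cB : countable B by exact: finite_set_countable.
apply: (card_le_trans le1); apply: (card_le_trans (card_le_seqs cB)).
exact: countableP.
Qed.

(** * Topology generated by a family of sets and their complements *)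

Section cylinder_topology.
Import ArrowAsProduct.
Context {X : choiceType} {I : eqType} (C : I -> X -> bool).

Definition cylinder (s : seq (bool * I)) : set X :=
  [set x | forall p, p \in s -> C p.2 x = p.1].

Definition cylinder_map (x : X) : I -> bool := C ^~ x.

(** Being induced from the Cantor cube [I -> bool], the topology is uniformizable, hence completely
    regular. *)
Definition cylinder_space : topologicalType := initial_topology cylinder_map.

Lemma open_coord (i : I) (b : bool) : open ([set x | C i x = b] : set cylinder_space).
Proof.
have -> : [set x | C i x = b] = cylinder_map @^-1` (@proj I (fun=> bool) i @^-1` [set b]).
  by [].
apply: open_comp; first by move=> ? _; exact: initial_continuous.
by apply: open_comp; [move=> ? _; exact: proj_continuous|exact: discrete_open].
Qed.

Lemma open_cylinder (s : seq (bool * I)) : open (cylinder s : set cylinder_space).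
Proof.
elim: s => [|p s IHs].
  by rewrite (_ : cylinder [::] = setT); [exact: openT|exact/seteqP].
rewrite (_ : cylinder _ = [set x | C p.2 x = p.1] `&` cylinder s).
  by apply: openI => //; exact: open_coord.
apply/seteqP; split=> [x xps|x [xp xs] q].
  by split=> [|q qs]; apply: xps; rewrite inE ?eqxx ?qs ?orbT.
by rewrite inE => /predU1P[->|/xs].
Qed.

Lemma cylinder_nbhs (U : set cylinder_space) (x : X) : open U -> U x ->
  exists s, cylinder s x /\ cylinder s `<=` U.
Proof.
move=> [V Vopen <-] Vx.
have : nbhs (cylinder_map x : forall i : I, bool) V by exact: open_nbhs_nbhs.
move=> [_ [[J JP <-] [W JW Wx] WV]].
have [L Lsub WE] := JP _ JW.
pose L' : {fset set (I -> bool)} := L.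
have /finite_seqP[l lE] : finite_set [set` L'] by exact: finite_fset.
have {}WE z : (W : set (I -> bool)) z <-> forall M, M \in l -> M z.
  rewrite -WE; split=> [zL M lM|zl M LM].
    by apply: zL; rewrite /= -/([set` L'] M) lE.
  by apply: zl; rewrite -/([set` l] M) -lE.
(* A subbasic set M constrains a single coordinate i, so prescribing the value of [C i] at x
   suffices. *)
have /choice[t tP] (M : set (I -> bool)) : exists t, M \in l ->
    cylinder t x /\ cylinder t `<=` cylinder_map @^-1` M.
  have [lM|nlM] := boolP (M \in l); last by exists [::].
  have LM : M \in L' by rewrite -/([set` L'] M) lE.
  have Mx : M (cylinder_map x).
    exact: (WE _).1 Wx M lM.
  have /set_mem[i _ [N _ NM]] := Lsub _ LM.
  exists [:: (C i x, i)] => _; split=> [p|z /(_ _ (mem_head _ _)) /= zx].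
    by rewrite inE => /eqP ->.
  move: Mx; rewrite /preimage /= -NM /cylinder_map /=.
  by rewrite zx.
exists (flatten (map t l)); split.
  by move=> p /flatten_mapP[M /tP[xM _]]; exact: xM.
move=> z zt; apply: WV; exists W => //; apply/WE => M lM.
have [_] := tP _ lM; apply=> p pM; apply: zt; apply/flatten_mapP; by exists M.
Qed.

Lemma pi_base_cylinder : pi_base (range cylinder : set (set cylinder_space)).
Proof.
split=> [_ [s _ <-]|U Uo [x Ux]]; first exact: open_cylinder.
have [s [xs sU]] := cylinder_nbhs Uo Ux.
by exists (cylinder s); split=> //; exists x.
Qed.

Lemma tychonoff_cylinder : (forall x y, x != y -> exists i, C i x != C i y) ->
  tychonoff_space cylinder_space.
Proof.
move=> sep; split; last first.
  exact: (@uniform_completely_regular Rdefinitions.R (initial_topology cylinder_map)).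
rewrite open_hausdorff => x y /sep[i Cxy].
exists ([set z | C i z = C i x], [set z | C i z = C i y]); first by rewrite !inE.
split; [exact: open_coord|exact: open_coord|].
by apply/eqP/seteqP; split=> // z [/= -> /eqP]; rewrite (negPf Cxy).
Qed.

End cylinder_topology.

(** * The example *)

Lemma mkseq_separates (s : seq (nat -> nat)) :
  exists m, forall k, m <= k -> forall d d', d \in s -> d' \in s ->
    mkseq d k = mkseq d' k -> d = d'.
Proof.
have /choice[w wP] (p : (nat -> nat) * (nat -> nat)) :
    exists i, p.1 i = p.2 i -> p.1 = p.2.
  have [->|neq] := pselect (p.1 = p.2); first by exists 0.
  have [i /eqP di] : exists i, p.1 i <> p.2 i.
    apply: contrapT => nex; apply: neq; apply/funext => i.
    by apply: contrapT => di; apply: nex; exists i.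
  by exists i => /eqP; rewrite (negPf di).
exists (\max_(p <- [seq (d, d') | d <- s, d' <- s]) (w p).+1) => k mk d d' ds d's dd'.
have wk : w (d, d') < k.
  apply: leq_trans mk.
  by apply: (leq_bigmax_seq (F := fun p => (w p).+1)) => //; exact: allpairs_f.
apply: (wP (d, d')) => /=; have /(congr1 (fun u => nth 0 u (w (d, d')))) := dd'.
by rewrite !nth_mkseq.
Qed.

(* A point (n, m, P) lies in the n-th dense set; P is a finite set of pairs
   (j, first m values of a function). *)
Definition point := (nat * nat * seq (nat * seq nat))%type.

Definition level (n : nat) : set point := [set x | x.1.1 = n].

Section example.
Context (D : set (nat -> nat)).

(* Up to finitely many points these sets are independent on every level; the
   even values of j serve to separate points, the odd ones to avoid finite sets. *)
Definition coord (i : nat * D) (x : point) : bool :=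
  let c := (pickle x).*2 in
  (c == i.1) || [&& i.1 < c, val i.2 x.1.1 < pickle x
                   & (i.1, mkseq (val i.2) x.1.2) \in x.2].

Local Notation cyl := (cylinder coord).

Lemma cylinder_level (s : seq (bool * (nat * D))) (n : nat) :
  {in s &, forall p q, p.2 = q.2 -> p.1 = q.1} -> cyl s `&` level n !=set0.
Proof.
move=> scons.
have [m0 m0P] := mkseq_separates [seq val p.2.2 | p <- s].
pose P k := [seq (p.2.1, mkseq (val p.2.2) k) | p <- s & p.1].
(* The third component lists exactly the pairs required to be true. Codes are injective in k, so
   some k puts the code above every j and every [d n]. *)
have /injective_gtn /(_ (\max_(p <- s) maxn p.2.1 (val p.2.2 n)))[k kP] :
    injective (fun k : nat => pickle ((n, m0 + k, P (m0 + k)) : point)).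
  by move=> k k' /(pcan_inj pickleK)[/addnI].
exists (n, m0 + k, P (m0 + k)); split=> // -[b [j d]] ps /=.
rewrite /coord /=; set c := pickle _ in kP *.
have : maxn j (val d n) < c.
  by apply: leq_ltn_trans kP; exact: (leq_bigmax_seq (F := fun p => maxn p.2.1 (val p.2.2 n)) _ ps).
rewrite gtn_max => /andP[jc ->].
have j2c : j < c.*2 by rewrite -addnn ltn_addr.
rewrite j2c (gtn_eqF j2c) /=.
case: b ps => ps.
  by apply/mapP; exists (true, (j, d)); rewrite ?mem_filter.
apply/negP => /mapP[[b [j' d']]]; rewrite mem_filter /= => /andP[b1 qs] [jj' dd'].
(* Segments of length at least [m0] determine the function, so a listed pair comes from a true
   constraint on the same index. *)
suff /(scons _ _ qs ps) /= : (j', d') = (j, d) by rewrite b1.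
have : val d = val d'.
  by apply: m0P dd'; rewrite ?leq_addr//; apply/mapP; [exists (false, (j, d))|exists (b, (j', d'))].
by move=> /val_inj ->; rewrite jj'.
Qed.

Lemma coord_separates (x y : point) : D !=set0 -> x != y ->
  exists i, coord i x != coord i y.
Proof.
move=> [d Dd]; pose d' : D := exist _ d (mem_set Dd).
wlog xy : x y / pickle x < pickle y => [wl nxy|_].
  have : pickle x != pickle y by rewrite (inj_eq (pcan_inj pickleK)).
  rewrite neq_ltn => /orP[/wl/(_ nxy)//|/wl].
  by rewrite eq_sym => /(_ nxy)[i]; exists i; rewrite eq_sym.
(* At y the first alternative holds; x has a smaller code, so both fail there. *)
exists ((pickle y).*2, d'); rewrite /coord /= eqxx /=.
have lt2 : (pickle x).*2 < (pickle y).*2 by rewrite ltn_double.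
by rewrite (ltn_eqF lt2) ltnNge (ltnW lt2).
Qed.

Local Notation space := (cylinder_space coord).

Lemma dense_level n : dense (level n : set space).
Proof.
move=> U U0 Uo; have [_ [[s _ <-] [x xs] sU]] := (pi_base_cylinder coord).2 U Uo U0.
have [|y [ys yn]] := @cylinder_level s n.
  (* The point x of the cylinder shows that its constraints are consistent. *)
  by move=> p q ps qs pq; rewrite -(xs _ ps) pq (xs _ qs).
by exists y; split=> //; exact: sU.
Qed.

Lemma not_S_separable_space : dominating D -> ~ S_separable space.
Proof.
move=> Ddom /(_ level dense_level)[F [FP Fhit]].
have /choice[h hP] n : exists b, forall x, F n x -> pickle (x : point) <= b.
  have /finite_seqP[l ->] := (FP n).1.
  by exists (\max_(x <- l) pickle x) => x lx; exact: (leq_bigmax_seq (F := fun x => pickle x)).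
have [d Dd [N _ hd]] := Ddom h.
(* Odd j excludes the equality with a doubled code. Its size excludes selected points on levels
   below N, and [h n <= d n] excludes those on later levels. *)
pose j := (\max_(n < N) h n).*2.+1.
pose s := [:: (true, (j, exist _ d (mem_set Dd) : D))].
have [|n /(_ (cyl s) erefl)[x [xs Fx]]] := Fhit [set cyl s] (finite_set1 _).
  move=> _ ->; split; first exact: open_cylinder.
  have [|x [xs _]] := @cylinder_level s 0; last by exists x.
  by move=> p q; rewrite !inE => /eqP -> /eqP ->.
have := xs _ (mem_head _ _); rewrite /coord /= ((FP n).2 x Fx) => /orP[/eqP/(congr1 odd)|].
  by rewrite /j /= !odd_double.
move=> /and3P[jx dx _].
have [Nn|nN] := leqP N n.
  by have := leq_trans (hP _ _ Fx) (hd n Nn); rewrite leqNgt dx.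
have : h n <= \max_(n < N) h n by exact: (leq_bigmax (Ordinal nN)).
move=> /(leq_trans (hP _ _ Fx)); rewrite -leq_double leqNgt.
by rewrite (leq_trans _ jx).
Qed.

Lemma pi_weight_space_le : infinite_set D -> pi_weight space #<= D.
Proof.
move=> Dinf; apply: card_le_trans ((pi_weightP space).2 _ (pi_base_cylinder coord)) _.
apply: (card_le_trans (card_image_le _ _)).
have -> : [set: seq (bool * (nat * D))] = seqs setT by apply/seteqP; split.
suff le1 : [set: bool * (nat * D)] #<= seqs D.
  apply: (card_le_trans (card_le_seqs le1)).
  apply: card_le_trans (card_seqs_le Dinf); apply: card_le_seqs.
  exact: card_seqs_le.
apply/(card_le_funP _ _ [::]).
(* The length codes the boolean and j; the successor keeps the sequence nonempty, so that d can be
   read off. *)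
exists (fun p => nseq (pickle (p.1, p.2.1)).+1 (val p.2.2)).
  by move=> p _ f /=; rewrite inE mem_nseq => /orP[/eqP ->|/andP[_ /eqP ->]]; exact: set_valP.
move=> [b [j d]] [b' [j' d']] _ _ /= [dd' nn].
have := congr1 size nn; rewrite !size_nseq => /(pcan_inj pickleK)[-> ->].
by rewrite (val_inj dd').
Qed.

End example.

Theorem corollary3p22 :
  (forall X : topologicalType,
     countable [set: X] -> tychonoff_space X -> ~ S_separable X ->
     dominating_number #<= pi_weight X) /\
  (exists Y : topologicalType,
     [/\ countable [set: Y], tychonoff_space Y,
         pi_weight Y #= dominating_number & ~ S_separable Y]).
Proof.
split=> [X cX _ nS|].
  exact: dominating_le_pi_base cX (pi_weightP X).1 nS.
have [Ddom _] := dominating_numberP.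
have Dinf : infinite_set dominating_number.
  by move=> /finite_set_countable; exact: dominating_uncountable.
pose Y := cylinder_space (@coord dominating_number).
have cY : countable [set: Y] by exact: (@countableP point).
have nS : ~ S_separable Y by exact: not_S_separable_space.
exists Y; split=> //.
  by apply: tychonoff_cylinder => x y; apply: coord_separates; exact: infinite_setN0.
rewrite card_eq_le pi_weight_space_le//=.
exact: dominating_le_pi_base cY (pi_weightP Y).1 nS.
Qed.
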